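(* Let $f:\mathbb{R}^d\to\mathbb{R}$ be convex and $1$-smooth, let $h:\mathbb{R}^d\to\mathbb{R}\cup\{+\infty\}$ be proper, closed and convex, let $F=f+h$, and let $x_*$ be a minimizer of $F$. For $n\ge2$, the iterates $x_0,\dots,x_n$ of the composite extension of the ($n$-step) optimized gradient method (OGM) satisfy $$F(x_n)-F(x_* )\le\frac{3+\sqrt5}{8\theta_n^2}\|x_0-x_*\|^2 .$$ Moreover $\dfrac{3+\sqrt5}{8\theta_n^2}\sim\dfrac{3+\sqrt5}{4n^2}$ as $n\to\infty$.
   Context: For each $n$, the sequence $\theta_0,\dots,\theta_n$ is defined by $\theta_0=1$, $\theta_i=\frac{1+\sqrt{1+4\theta_{i-1}^2}}{2}$ for $1\le i\le n-1$, and $\theta_n=\frac{1+\sqrt{1+8\theta_{n-1}^2}}{2}$ (so $\theta_n$ uses the special last-step rule). OGM stepsizes $\alpha_{i+1,j}$, $0\le j\le i\le n-1$: $$\alpha_{i+1,j}=\begin{cases}\frac{\theta_i-1}{\theta_{i+1}}\alpha_{i,j}&0\le j\le i-2,\\ \frac{\theta_i-1}{\theta_{i+1}}(\alpha_{i,i-1}-1)&j=i-1,\\ 1+\frac{2\theta_i-1}{\theta_{i+1}}&j=i.\end{cases}$$ Composite extension: from $x_0\in\mathbb{R}^d$, for $k=1,\dots,n$, $$x_k=x_{k-1}-\sum_{j=0}^{k-1}\alpha_{k,j}\big(\nabla f(x_j)+s_{j+1}\big),\qquad s_k\in\partial h(x_k);$$ equivalently $x_k=\mathrm{prox}_{\alpha_{k,k-1}h}\big(x_{k-1}-\sum_{j=0}^{k-2}\alpha_{k,j}(\nabla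 f(x_j)+s_{j+1})-\alpha_{k,k-1}\nabla f(x_{k-1})\big)$, with $s_k$ then determined by the displayed equation. Here $\mathrm{prox}_{\alpha h}(x)=\arg\min_z\{\alpha h(z)+\frac12\|z-x\|^2\}$. $1$-smooth means differentiable with $1$-Lipschitz gradient. $a_n\sim b_n$ means $a_n/b_n\to1$. *)

(* Defs.v *)
From HB Require Import structures.
From mathcomp Require Import all_boot all_order all_algebra.
From mathcomp Require Import all_classical all_reals all_analysis.

Set Implicit Arguments.
Unset Strict Implicit.
Unset Printing Implicit Defensive.

Import Order.TTheory GRing.Theory Num.Theory.
Import numFieldNormedType.Exports.

Local Open Scope classical_set_scope.
Local Open Scope ring_scope.

Section euclidean.
Context {R : realType} {d : nat}.
Implicit Types u v x : 'rV[R]_d.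

Definition dotv u v : R := \sum_(i < d) u 0 i * v 0 i.

(* The library norm on 'rV[R]_d is the sup norm; it induces the same topology,
   hence the same differentiability and closedness, but not the same Lipschitz
   constants, so the Euclidean norm is needed explicitly. *)
Definition enorm v : R := Num.sqrt (dotv v v).

Definition grad (f : 'rV[R]_d -> R) x : 'rV[R]_d :=
  \row_(i < d) 'D_(delta_mx 0 i) f x.

Definition smooth (L : R) (f : 'rV[R]_d -> R) : Prop :=
  (forall x, differentiable f x) /\
  (forall x y, enorm (grad f x - grad f y) <= L * enorm (x - y)).

End euclidean.

Section extended_valued.
Context {R : realType} {d : nat}.
Implicit Types (h : 'rV[R]_d -> \bar R) (f : 'rV[R]_d -> R).

Local Open Scope ereal_scope.

Definition proper_function h : Prop :=
  (forall x, h x != -oo) /\ (exists x, h x != +oo).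

Definition epigraph h : set ('rV[R]_d * R) := [set p | h p.1 <= p.2%:E].

Definition closed_function h : Prop := closed (epigraph h).

(* Restricting to 0 < t < 1 avoids products 0 * +oo. *)
Definition econvex h : Prop :=
  forall x y (t : R), (0 < t < 1)%R ->
    h (t *: x + (1 - t) *: y)%R <= t%:E * h x + (1 - t)%:E * h y.

(* When h is proper, a nonempty subdifferential forces h x to be finite. *)
Definition subdifferential h (x : 'rV[R]_d) : set 'rV[R]_d :=
  [set s | forall z, h x + (dotv s (z - x)%R)%:E <= h z].

Definition composite f h (x : 'rV[R]_d) : \bar R := (f x)%:E + h x.

Definition minimizer (F : 'rV[R]_d -> \bar R) (xs : 'rV[R]_d) : Prop :=
  forall z, F xs <= F z.

End extended_valued.

Section ogm.
Context {R : realType}.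

(* The index n is the horizon: the factor 8 replaces 4 at the last step i = n.
   Only the values at i <= n are meaningful. *)
Fixpoint theta (n i : nat) : R :=
  if i is i'.+1 then
    (1 + Num.sqrt (1 + (if i == n then 8 else 4) * theta n i' ^+ 2)) / 2
  else 1.

(* [ogm_step n k j] is alpha_{k,j} for the horizon n, meaningful for
   j < k <= n and set to 0 when k <= j. *)
Fixpoint ogm_step (n k j : nat) : R :=
  if k is i.+1 then
    if (j.+2 <= i)%N then
      (theta n i - 1) / theta n i.+1 * ogm_step n i j
    else if j.+1 == i then
      (theta n i - 1) / theta n i.+1 * (ogm_step n i j - 1)
    else if j == i then 1 + (2 * theta n i - 1) / theta n i.+1
    else 0
  else 0.

(* The update is implicit: the term j = k - 1 of the sum involves
   s_k \in \partial h(x_k).  The value s 0 is unused. *)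
Definition composite_ogm (d : nat) (f : 'rV[R]_d -> R) (h : 'rV[R]_d -> \bar R)
    (n : nat) (x s : nat -> 'rV[R]_d) : Prop :=
  forall k, (1 <= k <= n)%N ->
    x k = x k.-1 - \sum_(0 <= j < k) ogm_step n k j *: (grad f (x j) + s j.+1)
    /\ subdifferential h (x k) (s k).

End ogm.

Definition asymp_equiv {R : realType} (a b : nat -> R) : Prop :=
  (fun n => a n / b n) @ \oo --> (1 : R).

(* Main.v *)
Require Import Defs.
From HB Require Import structures.
From mathcomp Require Import all_boot all_order all_algebra.
From mathcomp Require Import all_classical all_reals all_analysis.
From mathcomp Require Import ring lra.

Set Implicit Arguments.
Unset Strict Implicit.
Unset Printing Implicit Defensive.

Import Order.TTheory GRing.Theory Num.Theory.
Import numFieldNormedType.Exports.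

Local Open Scope classical_set_scope.
Local Open Scope ring_scope.

(** Fix [xs], put [g* = grad f xs], and replace [x_k], [grad f x_k], [s_k] by
    [x_k - xs], [grad f x_k - g*], [s_k + g*], tilting [f] and [h] accordingly.
    With [z_{k+1} = z_k - 2 theta_k (g_k + s_{k+1})] the method reads
    [theta_{k+1} x_{k+1} = (theta_{k+1} - 1) (x_k - g_k - s_{k+1}) + z_{k+1}].
    The inequalities for [f] are combined with the weights of the classical OGM
    proof: [2 theta_k^2] on [(k, k+1)] and [2 theta_k] ([theta_n] at the end)
    on [(xs, k)].  For [h], the subgradient inequality of [s_k] is used at [xs],
    at [x_{k+1}] and at a weighted average of the earlier iterates; the weights
    are the ones for which the point paired with [s_k] becomes
    [eta_k x_0 + 2 theta_{k-1} z_k + 2 theta_{k-1}^2 (g_k + s_{k+1})] for [k < n].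
    All inner products then telescope into squares except [eta_k <s_k, x_0>],
    where [eta_k >= 0] and [\sum_k eta_k = 1].  Since
    [eta_k <= theta_{k-1} / theta_1], Young's inequality absorbs these terms at
    the price of the factor [1 + 1 / (2 theta_1) = (3 + sqrt 5) / 4]. *)

(** * Euclidean inner product *)

Section dot_product.
Context {R : realType} {d : nat}.
Implicit Types (u v w : 'rV[R]_d) (a : R).

Lemma dotvC u v : dotv u v = dotv v u.
Proof. by apply: eq_bigr => i _; rewrite mulrC. Qed.

Lemma dotvDl u v w : dotv (u + v) w = dotv u w + dotv v w.
Proof. by rewrite -big_split; apply: eq_bigr => i _; rewrite mxE mulrDl. Qed.

Lemma dotvZl a u v : dotv (a *: u) v = a * dotv u v.
Proof. by rewrite mulr_sumr; apply: eq_bigr => i _; rewrite mxE mulrA. Qed.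

Lemma dotvNl u v : dotv (- u) v = - dotv u v.
Proof. by rewrite -scaleN1r dotvZl mulN1r. Qed.

Lemma dotvDr u v w : dotv u (v + w) = dotv u v + dotv u w.
Proof. by rewrite dotvC dotvDl !(dotvC u). Qed.

Lemma dotvZr a u v : dotv u (a *: v) = a * dotv u v.
Proof. by rewrite dotvC dotvZl dotvC. Qed.

Lemma dotvNr u v : dotv u (- v) = - dotv u v.
Proof. by rewrite dotvC dotvNl dotvC. Qed.

Lemma dotv0r u : dotv u 0 = 0.
Proof. by rewrite -(scale0r u) dotvZr mul0r. Qed.

Definition dotvE := (dotvDl, dotvDr, dotvNl, dotvNr, dotvZl, dotvZr).

Lemma dotvv_ge0 u : 0 <= dotv u u.
Proof. by apply: sumr_ge0 => i _; rewrite -expr2 sqr_ge0. Qed.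

Lemma enorm_sq u : enorm u ^+ 2 = dotv u u.
Proof. by rewrite /enorm sqr_sqrtr// dotvv_ge0. Qed.

Lemma dotv_eq0 u : dotv u u = 0 -> u = 0.
Proof.
move=> /eqP; rewrite psumr_eq0 => [/allP u0|i _]; last by rewrite -expr2 sqr_ge0.
apply/rowP => i; have := u0 i; rewrite mem_index_enum => /(_ isT).
by rewrite /= mulf_eq0 orbb mxE => /eqP.
Qed.

Lemma cauchy_schwarz u v : dotv u v <= enorm u * enorm v.
Proof.
have [v0|v_gt0] := eqVneq (dotv v v) 0.
  have -> : v = 0 by exact: dotv_eq0.
  by rewrite dotv0r mulr_ge0// sqrtr_ge0.
have {}v_gt0 : 0 < dotv v v by rewrite lt_neqAle eq_sym v_gt0 dotvv_ge0.
have := dotvv_ge0 (dotv v v *: u - dotv u v *: v); rewrite !dotvE (dotvC v u).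
move=> H.
have {}H : 0 <= dotv v v * (dotv v v * dotv u u - dotv u v ^+ 2) by nra.
rewrite (pmulr_rge0 _ v_gt0) subr_ge0 in H.
rewrite (le_trans (ler_norm _))// -(ler_pXn2r (_ : 0 < 2)%N)// ?nnegrE//.
  by rewrite real_normK ?num_real// exprMn !enorm_sq mulrC.
by rewrite mulr_ge0// sqrtr_ge0.
Qed.

End dot_product.

(** * One step of the method *)

Section one_step.
Context {R : realType} {d : nat}.
Implicit Types (x z G g s Xi y w gy sy : 'rV[R]_d)
  (a b c f fy h gam eps eta q rho kap r mu : R).

(** Eliminates [G] from the running average. Here [a], [b] stand for [theta_k], [theta_{k+1}]; [q]
    is 2 at an ordinary step and 1 at the last; [rho] is the value that cancels the coefficient of
    [G]. *)
Lemma average_forward a b q rho eps x0 x z G y w :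
  q * (b ^+ 2 - b) = 2 * a ^+ 2 ->
  rho * (b + 2 * a - 1) = 2 * (a ^+ 2 - a) ->
  w = z - (2 * a) *: G ->
  b *: y = (b - 1) *: (x - G) + w ->
  (rho * (b - 1) + 2 * a ^+ 2) *: x - (2 * a - 1 - rho) *: z - eps *: x0
  = (rho * b + q * b ^+ 2) *: y - (q * b + 2 * a - 1) *: w - eps *: x0.
Proof.
move=> hq hrho -> hy; congr (_ - _).
have -> : (rho * b + q * b ^+ 2) *: y = (rho + q * b) *: (b *: y).
  by rewrite scalerA; congr (_ *: _); ring.
rewrite hy; apply/rowP => i; rewrite !mxE.
have e : rho * (b - 1) + 2 * a ^+ 2 = (rho + q * b) * (b - 1) by rewrite -hq; ring.
rewrite e.
transitivity ((rho + q * b) * ((b - 1) * (x 0 i - G 0 i) + (z 0 i - 2 * a * G 0 i))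
  - (q * b + 2 * a - 1) * (z 0 i - 2 * a * G 0 i)
  + (rho * (b + 2 * a - 1) + (q * (b ^+ 2 - b)) - 4 * a ^+ 2 + 2 * a) * G 0 i); last first.
  by rewrite hrho hq; ring.
ring.
Qed.

(** Matching the coefficients of [G] and [z] determines [rho] and [r]; those of [x] and [x0] then
    agree. The three terms on the right come from testing the subgradient inequality of [s] at [xs],
    at the next iterate and at the running average. *)
Lemma average_step a b c rho0 rho r eps x0 x z G y :
  rho * (c + 2 * b - 1) = 2 * a ^+ 2 ->
  r * (2 * b + 2 * a - 1) = 2 * b - 1 - rho ->
  c *: y = (c - 1) *: (x - G) + (z - (2 * b) *: G) ->
  let Xi := (rho0 * b + 2 * b ^+ 2) *: x - (2 * b + 2 * a - 1) *: z - eps *: x0 in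
  let m := rho0 * b + 2 * (b ^+ 2 - b) - 2 * a + 1 - eps in
  let eta := (1 - r) * eps in
  eta *: x0 + (2 * a) *: z + (2 * a ^+ 2) *: G =
  (2 * a + eta) *: x + (rho * c) *: (x - y) + (1 - r) *: (m *: x - Xi).
Proof.
move=> hrho hr hy Xi m eta.
have -> : (rho * c) *: (x - y) = rho *: (c *: x - c *: y).
  by rewrite -scalerA scalerBr.
rewrite hy /Xi /m /eta; apply/rowP => i; rewrite !mxE.
transitivity ((1 - r) * eps * x0 0 i + (2 * a) * z 0 i
    + rho * (c + 2 * b - 1) * G 0 i); first by rewrite hrho; ring.
apply/eqP; rewrite -subr_eq0; apply/eqP.
transitivity ((r * (2 * b + 2 * a - 1) - (2 * b - 1 - rho)) * (z 0 i - x 0 i));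
  last by rewrite hr; ring.
ring.
Qed.
Lemma prox_step a b c kap rho r eps x0 x z G y Xi s (mu h k : R) :
  let m := kap + 2 * (b ^+ 2 - b) - 2 * a + 1 - eps in
  let eta := (1 - r) * eps in
  0 <= r <= 1 -> 0 <= rho * c -> 0 <= 2 * a + eta ->
  eta *: x0 + (2 * a) *: z + (2 * a ^+ 2) *: G =
    (2 * a + eta) *: x + (rho * c) *: (x - y) + (1 - r) *: (m *: x - Xi) ->
  m * h + dotv s (Xi - m *: x) <= mu ->
  h <= dotv s x -> h + dotv s (y - x) <= k ->
  (2 * a + eta) * h + rho * c * (h - k) + (1 - r) * (m * h - mu) <=
  dotv s (eta *: x0 + (2 * a) *: z + (2 * a ^+ 2) *: G).
Proof.
move=> m eta /andP[r0 r1] rc ae -> hmu hx hk.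
have e1 : dotv s (Xi - m *: x) = - dotv s (m *: x - Xi) by rewrite -dotvNr opprB.
have e2 : dotv s (y - x) = - dotv s (x - y) by rewrite -dotvNr opprB.
rewrite e1 in hmu; rewrite e2 in hk.
rewrite dotvDr dotvDr !dotvZr.
move: (dotv s (m *: x - Xi)) (dotv s (x - y)) hmu hk => D1 D2 hmu hk.
apply: lerD; first apply: lerD.
- exact: ler_wpM2l.
- by apply: ler_wpM2l => //; lra.
- by apply: ler_wpM2l; lra.
Qed.

(** The two inequalities are added with weights [2 a^2] and [q b]. As [q b^2 = 2 a^2 + q b], this
    produces [q b^2 fy], and the recurrence for [y] removes [<gy, x>] and [<gy, y>]. *)
Lemma smooth_step a b q x y w g gy s f fy :
  0 <= a -> 0 <= q * b ->
  q * (b ^+ 2 - b) = 2 * a ^+ 2 ->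
  b *: y = (b - 1) *: (x - (g + s)) + w ->
  fy + dotv gy (x - y) + dotv (g - gy) (g - gy) / 2 <= f ->
  fy - dotv gy y + dotv gy gy / 2 <= 0 ->
  q * b ^+ 2 * fy <= 2 * a ^+ 2 * f + q * b * dotv gy w
    - 2 * a ^+ 2 * dotv gy s - a ^+ 2 * dotv g g - q * b ^+ 2 / 2 * dotv gy gy.
Proof.
move=> a0 qb0 hq hy h1 h2.
have {}h1 : 2 * a ^+ 2 * (fy + dotv gy (x - y) + dotv (g - gy) (g - gy) / 2 - f) <= 0.
  by rewrite mulr_ge0_le0 ?subr_le0// mulr_ge0// sqr_ge0.
have {}h2 : q * b * (fy - dotv gy y + dotv gy gy / 2) <= 0.
  by rewrite mulr_ge0_le0.
have e : b * dotv gy y = (b - 1) * (dotv gy x - dotv gy g - dotv gy s) + dotv gy w.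
  by rewrite -dotvZr hy !dotvE; ring.
rewrite !dotvE (dotvC g gy) in h1 h2.
rewrite -subr_le0.
suff -> : q * b ^+ 2 * fy - (2 * a ^+ 2 * f + q * b * dotv gy w
    - 2 * a ^+ 2 * dotv gy s - a ^+ 2 * dotv g g - q * b ^+ 2 / 2 * dotv gy gy) =
  2 * a ^+ 2 * (fy + (dotv gy x - dotv gy y)
    + (dotv g g - dotv gy g - (dotv gy g - dotv gy gy)) / 2 - f)
  + q * b * (fy - dotv gy y + dotv gy gy / 2) by lra.
have -> : a ^+ 2 = q * (b ^+ 2 - b) / 2 by rewrite hq; field.
apply/eqP; rewrite -subr_eq0; apply/eqP.
transitivity (q * b * (b * dotv gy y
  - ((b - 1) * (dotv gy x - dotv gy g - dotv gy s) + dotv gy w))); last by rewrite e; ring.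
by field.
Qed.

(** With [z = w + 2 a (g + s)], the sum leaves [-(a^2 + a) |s|^2]. The part [a^2] absorbs the cross
    term [2 a^2 <s, sy>], creating the [sy] term of the next potential; the part [a] pays Young's
    inequality for [eta <s, x0>]. *)
Lemma energy_step a b gam eps eta x0 x y z w g gy s sy f fy (H H' : R) :
  0 < gam -> 0 <= a -> 0 <= b -> 0 <= eta -> eta <= 2 * gam * a ->
  b ^+ 2 - b = a ^+ 2 ->
  w = z - (2 * a) *: (g + s) ->
  b *: y = (b - 1) *: (x - (g + s)) + w ->
  fy + dotv gy (x - y) + dotv (g - gy) (g - gy) / 2 <= f ->
  fy - dotv gy y + dotv gy gy / 2 <= 0 ->
  2 * a ^+ 2 * f + H <=
    (1 + gam * (1 - eps)) / 2 * dotv x0 x0 - dotv z z / 2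
    + 2 * a * dotv g z - a ^+ 2 * dotv g g + (a ^+ 2 - a) * dotv s s ->
  H' - H <= dotv s (eta *: x0 + (2 * a) *: w + (2 * a ^+ 2) *: (gy + sy)) ->
  2 * b ^+ 2 * fy + H' <=
    (1 + gam * (1 - (eps - eta))) / 2 * dotv x0 x0 - dotv w w / 2
    + 2 * b * dotv gy w - b ^+ 2 * dotv gy gy + (b ^+ 2 - b) * dotv sy sy.
Proof.
move=> gam0 a0 b0 eta0 etaa hb hw hy h1 h2 hE hH.
have hq : 2 * (b ^+ 2 - b) = 2 * a ^+ 2 by rewrite hb.
have b20 : 0 <= 2 * b by lra.
have := smooth_step a0 b20 hq hy h1 h2.
have : 0 <= a ^+ 2 * dotv (s - sy) (s - sy) by rewrite mulr_ge0 ?sqr_ge0 ?dotvv_ge0.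
have : eta * dotv s x0 <= eta * gam / 2 * dotv x0 x0 + a * dotv s s.
  have := dotvv_ge0 (gam *: x0 - s).
  rewrite !dotvE (dotvC x0 s) => hh.
  have {}hh : 2 * gam * dotv s x0 <= gam ^+ 2 * dotv x0 x0 + dotv s s by lra.
  have := ler_wpM2l eta0 hh => {}hh.
  have h3 : eta * dotv s s <= 2 * gam * a * dotv s s by rewrite ler_wpM2r ?dotvv_ge0.
  have g20 : 0 < 2 * gam by lra.
  rewrite -(ler_pM2l g20); nra.
have -> : 2 * b ^+ 2 / 2 = b ^+ 2 by field.
rewrite hb; move: hH; rewrite hw !dotvE.
rewrite !(dotvC s gy) !(dotvC s g) !(dotvC z g) !(dotvC z s) !(dotvC sy s).
lra.
Qed.

Lemma energy_last a b gam eps x0 x y z w g gy s f fy h (H : R) :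
  0 < gam -> 1 <= a -> 1 <= b -> 0 <= eps -> eps <= 2 * gam * a ->
  b ^+ 2 - b = 2 * a ^+ 2 ->
  w = z - (2 * a) *: (g + s) ->
  b *: y = (b - 1) *: (x - (g + s)) + w ->
  fy + dotv gy (x - y) + dotv (g - gy) (g - gy) / 2 <= f ->
  fy - dotv gy y + dotv gy gy / 2 <= 0 ->
  2 * a ^+ 2 * f + H <=
    (1 + gam * (1 - eps)) / 2 * dotv x0 x0 - dotv z z / 2
    + 2 * a * dotv g z - a ^+ 2 * dotv g g + (a ^+ 2 - a) * dotv s s ->
  b ^+ 2 * h - H <= dotv s (eps *: x0 + (b + 2 * a - 1) *: w) ->
  b ^+ 2 * (fy + h) <= (1 + gam) / 2 * dotv x0 x0.
Proof.
move=> gam0 a1 b1 eps0 epsa hb hw hy h1 h2 hE hH.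
have hq : 1 * (b ^+ 2 - b) = 2 * a ^+ 2 by rewrite hb mul1r.
have b20 : 0 <= 1 * b by lra.
have a0 : 0 <= a by lra.
have := smooth_step a0 b20 hq hy h1 h2.
rewrite !mul1r.
have : eps * dotv s x0 <= eps * gam / 2 * dotv x0 x0 + a * dotv s s.
  have := dotvv_ge0 (gam *: x0 - s).
  rewrite !dotvE (dotvC x0 s) => hh.
  have {}hh : 2 * gam * dotv s x0 <= gam ^+ 2 * dotv x0 x0 + dotv s s by lra.
  have := ler_wpM2l eps0 hh => {}hh.
  have h3 : eps * dotv s s <= 2 * gam * a * dotv s s by rewrite ler_wpM2r ?dotvv_ge0.
  have g20 : 0 < 2 * gam by lra.
  rewrite -(ler_pM2l g20); nra.
(* As [2 a^2 = b (b - 1)], the remaining quadratic form in [w], [gy], [s] is minus half of this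
   square minus [(b - 1) / 2 |s|^2]. *)
have := dotvv_ge0 (w - b *: gy - (b - 1) *: s).
have : 0 <= (b - 1) / 2 * dotv s s by rewrite mulr_ge0 ?dotvv_ge0//; lra.
have hbs : b ^+ 2 * dotv s s = b * dotv s s + 2 * a ^+ 2 * dotv s s by rewrite -hb; ring.
have hbg : b ^+ 2 * dotv gy s = b * dotv gy s + 2 * a ^+ 2 * dotv gy s.
  by rewrite -hb; ring.
have hz : z = w + (2 * a) *: (g + s) by rewrite hw subrK.
move: hH hE; rewrite hz !dotvE.
rewrite !(dotvC s gy) !(dotvC s g) !(dotvC w g) !(dotvC w s) !(dotvC w gy).
move: hbs hbg; lra.
Qed.

End one_step.

(** * The potential *)

Section scalars.
Context {R : realType}.
Implicit Types a b c : R.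

Lemma step_bounds a b c rho r : 1 <= a -> 1 <= b -> b <= c -> b ^+ 2 - b = a ^+ 2 ->
  rho * (c + 2 * b - 1) = 2 * a ^+ 2 ->
  r * (2 * b + 2 * a - 1) = 2 * b - 1 - rho ->
  [/\ 0 <= rho, 0 <= r & 3 * r <= 2].
Proof.
move=> a1 b1 bc hb hrho hr.
have ba : b <= a + 1 by rewrite -(ler_pXn2r (_ : 0 < 2)%N) ?nnegrE//; nra.
have rho0 : 0 <= rho.
  by rewrite -(@pmulr_lge0 _ (c + 2 * b - 1)) ?hrho ?mulr_ge0 ?sqr_ge0//; lra.
have rhob : rho <= 2 * b - 1.
  rewrite -(@ler_pM2r _ (c + 2 * b - 1)); last lra.
  rewrite hrho -hb.
  have : (2 * b - 1) * (b + 2 * b - 1) <= (2 * b - 1) * (c + 2 * b - 1).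
    by rewrite ler_wpM2l; lra.
  nra.
split=> //.
- by rewrite -(@pmulr_lge0 _ (2 * b + 2 * a - 1)) ?hr; lra.
- rewrite -(@ler_pM2r _ (2 * b + 2 * a - 1)); last lra.
  by rewrite -mulrA hr; lra.
Qed.

(** This is [nu], the weight with which the newest iterate enters the running average. As
    [rho0 <= b], the subtracted term is at most [3 r b^2 <= 2 b^2]. *)
Lemma weight_ge0 a b c kap rho0 rho r : 1 <= a -> 1 <= b -> b <= c ->
  b ^+ 2 - b = a ^+ 2 ->
  rho * (c + 2 * b - 1) = 2 * a ^+ 2 ->
  r * (2 * b + 2 * a - 1) = 2 * b - 1 - rho ->
  rho0 * (b + 2 * a - 1) = 2 * (a ^+ 2 - a) -> kap = rho0 * b ->
  0 <= rho * (c - 1) + 2 * b ^+ 2 - r * (kap + 2 * b ^+ 2).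
Proof.
move=> a1 b1 bc hb hrho hr hrho0 ->.
have [rho_ge0 r_ge0 r_le] := step_bounds a1 b1 bc hb hrho hr.
have ab : a <= b by rewrite -(ler_pXn2r (_ : 0 < 2)%N) ?nnegrE//; nra.
have rho0b : rho0 <= b.
  rewrite -(@ler_pM2r _ (b + 2 * a - 1)); last lra.
  rewrite hrho0 -hb; nra.
have : rho0 * b <= b ^+ 2 by rewrite expr2 ler_wpM2r; lra.
move=> /(ler_wpM2l r_ge0).
have : 0 <= rho * (c - 1) by rewrite mulr_ge0//; lra.
have : 3 * r * b ^+ 2 <= 2 * b ^+ 2 by rewrite ler_wpM2r ?sqr_ge0.
nra.
Qed.

(** The case [k = 0] of the bound on [eta], with [b] the golden ratio. Multiplied by [2 b + 1], the
    claim becomes [rho b <= 1], for which [rho <= 6/10] and [b <= 5/3] are just sharp enough. *)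
Lemma first_step_bound b c rho r : 1 <= b -> b <= c -> b ^+ 2 - b = 1 ->
  rho * (c + 2 * b - 1) = 2 ->
  r * (2 * b + 1) = 2 * b - 1 - rho ->
  (1 - r) * b <= 1.
Proof.
move=> b1 bc hb hrho hr.
have b32 : 3 / 2 <= b by rewrite leNgt; apply/negP => ?; nra.
have rho0 : 0 <= rho by rewrite -(@pmulr_lge0 _ (c + 2 * b - 1)) ?hrho//; lra.
have rhob : rho <= 6 / 10.
  rewrite -(@ler_pM2r _ (c + 2 * b - 1)); last lra.
  by rewrite hrho; lra.
have bu : b <= 5 / 3 by rewrite leNgt; apply/negP => ?; nra.
rewrite -(@ler_pM2r _ (2 * b + 1)); last lra.
have -> : (1 - r) * b * (2 * b + 1) = b * (2 * b + 1 - r * (2 * b + 1)) by ring.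
rewrite hr; nra.
Qed.

End scalars.

(** * The invariant and its induction along the iterates *)

Section potential.
Context {R : realType} {d : nat}.
Variables (n : nat) (t f h : nat -> R) (x z g s : nat -> 'rV[R]_d).

Hypotheses (n2 : (2 <= n)%N) (t0 : t 0 = 1) (t_ge1 : forall k, 1 <= t k)
  (tS : forall k, (k.+1 < n)%N -> t k.+1 ^+ 2 - t k.+1 = t k ^+ 2)
  (tlast : t n ^+ 2 - t n = 2 * t n.-1 ^+ 2)
  (z0 : z 0 = x 0)
  (zS : forall k, (k < n)%N -> z k.+1 = z k - (2 * t k) *: (g k + s k.+1))
  (xS : forall k, (k < n)%N -> t k.+1 *: x k.+1 =
     (t k.+1 - 1) *: (x k - (g k + s k.+1)) + z k.+1)
  (f_next : forall k, (k < n)%N -> f k.+1 + dotv (g k.+1) (x k - x k.+1)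
     + dotv (g k - g k.+1) (g k - g k.+1) / 2 <= f k)
  (f_opt : forall k, (k <= n)%N ->
     f k - dotv (g k) (x k) + dotv (g k) (g k) / 2 <= 0)
  (h_sub : forall i j, (0 < i <= n)%N -> (0 < j <= n)%N ->
     h i + dotv (s i) (x j - x i) <= h j)
  (h_opt : forall i, (0 < i <= n)%N -> h i <= dotv (s i) (x i)).

(** The golden ratio, since [t 1 ^+ 2 = t 1 + 1]. The Young parameter [gam] satisfies
    [1 + gam = phi^2 / 2]. *)
Let phi := t 1.
Let gam := (2 * phi)^-1.
(** For [k > 0], [kap k] is the weight of the subgradient inequality of [s k] tested at [x k.+1]. *)
Let rho k := 2 * (t k ^+ 2 - t k) / (t k.+1 + 2 * t k - 1).
Let kap k := rho k * t k.+1.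
Let mass eps k := kap k + 2 * (t k ^+ 2 - t k) + 1 - eps.
Let Xi eps k := (rho k * (t k.+1 - 1) + 2 * t k ^+ 2) *: x k
  - (2 * t k - 1 - rho k) *: z k - eps *: x 0.

(* [mass] and [Xi] are the total weight and the weighted sum of the iterates in the
   running average of [x_1, ..., x_k]; [mu] is the corresponding sum of values
   of [h], and [1 - eps = eta_1 + ... + eta_k]. *)
Definition invariant k (eps mu : R) :=
  [/\ 0 <= eps <= 1, (k = 0)%N -> eps = 1,
    forall j, (0 < j <= n)%N ->
      mass eps k * h j + dotv (s j) (Xi eps k - mass eps k *: x j) <= mu
    & 2 * t k ^+ 2 * f k + (mu - kap k * h k.+1) <=
      (1 + gam * (1 - eps)) / 2 * dotv (x 0) (x 0) - dotv (z k) (z k) / 2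
      + 2 * t k * dotv (g k) (z k) - t k ^+ 2 * dotv (g k) (g k)
      + (t k ^+ 2 - t k) * dotv (s k.+1) (s k.+1)].

Lemma t_nondecreasing k : (k.+1 <= n)%N -> t k <= t k.+1.
Proof.
rewrite leq_eqVlt => /orP[/eqP kn|kn].
  have := tlast; rewrite -kn /= => e.
  rewrite -(ler_pXn2r (_ : 0 < 2)%N) ?nnegrE//;
    by have := t_ge1 k; have := t_ge1 k.+1; nra.
have := tS kn => e.
rewrite -(ler_pXn2r (_ : 0 < 2)%N) ?nnegrE//;
  by have := t_ge1 k; have := t_ge1 k.+1; nra.
Qed.

Lemma phi_le k : (0 < k <= n)%N -> phi <= t k.
Proof.
case: k => // k; elim: k => [//|k IH] kn.
by apply: le_trans (IH (ltnW kn)) (t_nondecreasing kn).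
Qed.

Lemma phi_gt0 : 0 < phi. Proof. exact: lt_le_trans (t_ge1 1). Qed.

Lemma gam_gt0 : 0 < gam.
Proof. by rewrite invr_gt0 mulr_gt0// phi_gt0. Qed.

Lemma gam2 a : 2 * gam * a = a / phi.
Proof. by rewrite /gam; field; rewrite gt_eqF// phi_gt0. Qed.

Lemma rhoE k : rho k * (t k.+1 + 2 * t k - 1) = 2 * (t k ^+ 2 - t k).
Proof.
rewrite divfK// gt_eqF//; have := t_ge1 k; have := t_ge1 k.+1; lra.
Qed.

Lemma invariant0 : invariant 0 1 0.
Proof.
have rho0 : rho 0 = 0 by rewrite /rho t0 expr1n subrr mulr0 mul0r.
split; rewrite ?lexx ?ler01//.
  move=> j jn; rewrite /mass /Xi /kap rho0 t0 z0.
  (* As [theta_0 = 1], the average starts empty: [mass] and [Xi] both vanish. *)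
  suff -> : (0 * (t 1 - 1) + 2 * 1 ^+ 2) *: x 0 - (2 * 1 - 1 - 0) *: x 0 - 1 *: x 0
    - (0 * t 1 + 2 * (1 ^+ 2 - 1) + 1 - 1) *: x j = 0.
    by rewrite dotv0r; lra.
  by apply/rowP => i; rewrite !mxE; ring.
have := @f_opt 0 isT; rewrite /kap rho0 t0 z0; lra.
Qed.

(** The old average is scaled by [r] and [x_{k+1}] enters with weight [nu]. The removed fraction
    [1 - r] is spent on the inequality of [s_{k+1}], which uses up [eta = (1 - r) eps]. *)
Lemma invariantS k eps mu : (k.+1 < n)%N -> invariant k eps mu ->
  exists eps' mu', invariant k.+1 eps' mu'.
Proof.
move=> kn [/andP[eps0 eps1] epsk hmu hE].
have kn' : (k < n)%N by exact: ltnW.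
set a := t k; set b := t k.+1; set c := t k.+2.
have a1 : 1 <= a by exact: t_ge1.
have b1 : 1 <= b by exact: t_ge1.
have bc : b <= c by exact: t_nondecreasing.
have hb : b ^+ 2 - b = a ^+ 2 by exact: tS.
have hrho : rho k.+1 * (c + 2 * b - 1) = 2 * a ^+ 2 by rewrite rhoE hb.
pose r := (2 * b - 1 - rho k.+1) / (2 * b + 2 * a - 1).
have hr : r * (2 * b + 2 * a - 1) = 2 * b - 1 - rho k.+1.
  by rewrite divfK// gt_eqF//; lra.
have hkap := rhoE k; rewrite -/a -/b in hkap.
have [rho_ge0 r0 r23] := step_bounds a1 b1 bc hb hrho hr.
have nu0 := weight_ge0 a1 b1 bc hb hrho hr hkap erefl.
set nu := (X in 0 <= X) in nu0.
pose eta := (1 - r) * eps.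
have eta0 : 0 <= eta by rewrite mulr_ge0//; lra.
have hw := zS kn'; have hy := xS kn'; rewrite -/a -/b in hw hy.
have hy2 := xS kn; rewrite (zS kn) -/b -/c in hy2.
have hq : 2 * (b ^+ 2 - b) = 2 * a ^+ 2 by rewrite hb.
have XiE := average_forward eps (x 0) hq hkap hw hy.
have XiE' : Xi eps k = (rho k * b + 2 * b ^+ 2) *: x k.+1
    - (2 * b + 2 * a - 1) *: z k.+1 - eps *: x 0 by exact: XiE.
have massE : mass eps k = rho k * b + 2 * (b ^+ 2 - b) - 2 * a + 1 - eps.
  by rewrite /mass /kap hq -/a -/b; ring.
have := average_step (rho k) eps (x 0) hrho hr hy2.
rewrite /= -massE -XiE' => pE.
have kn0 : (0 < k.+1 <= n)%N by exact: ltnW.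
have etaa : eta <= 2 * gam * a.
  rewrite gam2 ler_pdivlMr ?phi_gt0//.
  (* For [k > 0], [eta <= 1 <= a / phi]. For [k = 0], [a = 1 < phi], so the sharper
     [first_step_bound] is applied with [eps = 1]. *)
  have [k0|k0] := posnP k.
    have e1 : eps = 1 by exact: epsk.
    have a_1 : a = 1 by rewrite /a k0 t0.
    have pb : phi = b by rewrite /b k0.
    rewrite /eta e1 mulr1 a_1 pb; apply: (@first_step_bound _ b c (rho k.+1)) => //.
    - by rewrite hb a_1 expr1n.
    - by rewrite hrho a_1 expr1n mulr1.
    - by rewrite -hr a_1; ring.
  have pa : phi <= a by apply: phi_le; rewrite k0 ltnW.
  apply: le_trans pa; rewrite -[leRHS]mul1r ler_wpM2r ?(ltW phi_gt0)//.
  by rewrite /eta mulr_ile1//; lra.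
pose mu' := r * mu + nu * h k.+1.
exists (r * eps), mu'; split=> //.
- by rewrite mulr_ge0//= mulr_ile1//; lra.
- move=> j jn.
  have massS : mass (r * eps) k.+1 = r * mass eps k + nu.
    rewrite massE /mass /nu /kap -/c -/b.
    apply/eqP; rewrite -subr_eq0; apply/eqP.
    transitivity (- (2 * b - 1 - rho k.+1 - r * (2 * b + 2 * a - 1))); first by ring.
    by rewrite hr; ring.
  have XiS : Xi (r * eps) k.+1 = r *: Xi eps k + nu *: x k.+1.
    rewrite XiE' /Xi -/b -/c -hr /nu; apply/rowP => i; rewrite !mxE; ring.
  have -> : Xi (r * eps) k.+1 - mass (r * eps) k.+1 *: x j =
      r *: (Xi eps k - mass eps k *: x j) + nu *: (x k.+1 - x j).
    by rewrite massS XiS; apply/rowP => i; rewrite !mxE; ring.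
  rewrite dotvDr !dotvZr massS.
  have := ler_wpM2l r0 (hmu _ jn).
  have := ler_wpM2l nu0 (h_sub jn kn0).
  rewrite /mu'; lra.
- have -> : r * eps = eps - eta by rewrite /eta; ring.
  apply: (energy_step gam_gt0 _ _ eta0 etaa hb hw hy (f_next kn') (f_opt _) hE).
  + by lra.
  + by lra.
  + exact: ltnW.
  have rc : 0 <= rho k.+1 * c by rewrite mulr_ge0//; lra.
  have r01 : 0 <= r <= 1 by apply/andP; split=> //; lra.
  have ae : 0 <= 2 * a + eta by lra.
  have hk : (0 < k.+2 <= n)%N by [].
  rewrite massE in pE hmu.
  have := prox_step r01 rc ae pE (hmu _ kn0) (h_opt kn0) (h_sub kn0 hk).
  (* The two sides differ by a multiple of [h k.+1] that vanishes by the choice of [r]. *)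
  apply: le_trans; rewrite le_eqVlt; apply/orP; left; apply/eqP.
  rewrite /mu' /nu /kap -/b -/c.
  apply/eqP; rewrite -subr_eq0; apply/eqP.
  transitivity ((2 * b - 1 - rho k.+1 - r * (2 * b + 2 * a - 1)) * h k.+1); last first.
    by rewrite hr; ring.
  by rewrite /eta; ring.
Qed.

Lemma invariant_ex k : (k < n)%N -> exists eps mu, invariant k eps mu.
Proof.
elim: k => [_|k IH kn]; first by exists 1, 0; exact: invariant0.
by have [eps [mu]] := IH (ltnW kn); exact: invariantS.
Qed.

(** At the last step [s_n] is tested only at [xs] and at the whole running average, so all the
    remaining [eps] is spent and the [eta_k] sum to 1. *)
Lemma potential_bound :
  t n ^+ 2 * (f n + h n) <= phi ^+ 2 / 4 * dotv (x 0) (x 0).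
Proof.
have [k nE] : exists k, n = k.+1 by case: (n) n2 => // k _; exists k.
have kn : (k < n)%N by rewrite nE.
have k_gt0 : (0 < k)%N by rewrite -ltnS -nE.
have [eps [mu [/andP[eps0 eps1] _ hmu hE]]] := invariant_ex kn.
set a := t k; set b := t n.
have a1 : 1 <= a by exact: t_ge1.
have b1 : 1 <= b by exact: t_ge1.
have hb : b ^+ 2 - b = 2 * a ^+ 2 by rewrite tlast nE.
have hkap := rhoE k; rewrite -nE -/a -/b in hkap.
have hw := zS kn; have hy := xS kn; rewrite -nE -/a -/b in hw hy.
have hq : 1 * (b ^+ 2 - b) = 2 * a ^+ 2 by rewrite hb mul1r.
have XiE := average_forward eps (x 0) hq hkap hw hy.
have XiE' : Xi eps k = (kap k + b ^+ 2) *: x n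
    - (b + 2 * a - 1) *: z n - eps *: x 0.
  by have := XiE; rewrite !mul1r /Xi /kap -nE.
have pE : phi ^+ 2 = phi + 1.
  have := @tS 0 n2; rewrite t0 => e; rewrite -[phi ^+ 2](subrK phi) e; ring.
have -> : phi ^+ 2 / 4 = (1 + gam) / 2.
  rewrite pE /gam; have p0 : phi != 0 by rewrite gt_eqF ?phi_gt0.
  apply: (mulIf p0); transitivity ((phi ^+ 2 + phi) / 4); first by field.
  by rewrite pE; field.
have epsa : eps <= 2 * gam * a.
  rewrite gam2 ler_pdivlMr ?phi_gt0//.
  have pa : phi <= a by apply: phi_le; rewrite k_gt0 ltnW.
  apply: le_trans pa; rewrite -[leRHS]mul1r ler_wpM2r ?(ltW phi_gt0)//.
rewrite -nE in hE.
have fn := f_next kn; rewrite -nE in fn.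
have n0 : (0 < n <= n)%N by rewrite nE leqnn.
apply: (energy_last gam_gt0 a1 b1 eps0 epsa hb hw hy fn (f_opt (leqnn n)) hE).
have hm := hmu n n0; have ho := h_opt n0.
have massE : mass eps k + (eps + b + 2 * a - 1) = kap k + b ^+ 2.
  by rewrite /mass -/a -[b ^+ 2](subrK b) hb; ring.
have -> : eps *: x 0 + (b + 2 * a - 1) *: z n =
    (eps + b + 2 * a - 1) *: x n - (Xi eps k - mass eps k *: x n).
  rewrite XiE' -massE; apply/rowP => i; rewrite !mxE; ring.
rewrite dotvDr dotvNr dotvZr.
have e0 : 0 <= eps + b + 2 * a - 1 by lra.
have := ler_wpM2l e0 ho.
have e1 : (mass eps k + (eps + b + 2 * a - 1)) * h n = (kap k + b ^+ 2) * h n.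
  by rewrite massE.
lra.
Qed.

End potential.

(** * The OGM step sizes *)

Section theta_facts.
Context {R : realType}.
Implicit Types n i : nat.

Lemma thetaS n i : theta n i.+1 ^+ 2 - theta n i.+1 =
  (if i.+1 == n then 2 else 1) * theta n i ^+ 2 :> R.
Proof.
rewrite /=; set c : R := if _ then 8 else 4; set c' : R := if _ then 2 else 1.
have cE : c = 4 * c' by rewrite /c /c'; case: ifP => _; ring.
have c'0 : 0 <= c' by rewrite /c'; case: ifP.
have : Num.sqrt (1 + c * theta n i ^+ 2) ^+ 2 = 1 + c * theta n i ^+ 2.
  by rewrite sqr_sqrtr// cE addr_ge0// mulr_ge0 ?sqr_ge0// mulr_ge0.
move: (Num.sqrt _) => q qE.
transitivity ((q ^+ 2 - 1) / 4); first by field.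
by rewrite qE cE; field.
Qed.

Lemma theta_ge1 n i : 1 <= theta n i :> R.
Proof.
case: i => [//|i] /=; set c : R := if _ then 8 else 4.
have c0 : 0 <= c by rewrite /c; case: ifP.
suff : 1 <= Num.sqrt (1 + c * theta n i ^+ 2) by lra.
by rewrite -[leLHS]sqrtr1 ler_wsqrtr// lerDl mulr_ge0// sqr_ge0.
Qed.

Lemma ogm_step_last n k : ogm_step n k.+1 k = 1 + (2 * theta n k - 1) / theta n k.+1 :> R.
Proof. by rewrite [LHS]/= ltnNge leqnSn (gtn_eqF (ltnSn k)) eqxx. Qed.

Lemma ogm_step_prev n k : ogm_step n k.+2 k =
  (theta n k.+1 - 1) / theta n k.+2 * (ogm_step n k.+1 k - 1) :> R.
Proof. by rewrite [LHS]/= ltnn eqxx. Qed.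

Lemma ogm_step_early n k j : (j < k)%N -> ogm_step n k.+2 j =
  (theta n k.+1 - 1) / theta n k.+2 * ogm_step n k.+1 j :> R.
Proof. by move=> jk; rewrite [LHS]/= ltnS jk. Qed.

End theta_facts.

(** Rows [k+1] and [k+2] of the step sizes are proportional in the columns before [k], so
    [x_{k+2} - x_{k+1}] is [(theta_{k+1} - 1) / theta_{k+2}] times [x_{k+1} - x_k], up to multiples
    of [G_k] and [G_{k+1}]. *)
Lemma ogm_momentum (R : realType) (d n : nat) (x G z : nat -> 'rV[R]_d) :
  (forall k, (1 <= k <= n)%N ->
    x k = x k.-1 - \sum_(0 <= j < k) ogm_step n k j *: G j) ->
  z 0 = x 0 -> (forall k, z k.+1 = z k - (2 * theta n k) *: G k) ->
  forall k, (k < n)%N ->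
  theta n k.+1 *: x k.+1 = (theta n k.+1 - 1) *: (x k - G k) + z k.+1.
Proof.
move=> xE z0 zS; elim=> [|k IH] kn; have t0 i : theta n i != 0 :> R
  by rewrite gt_eqF// (lt_le_trans ltr01 (theta_ge1 n i)).
  rewrite (xE 1) ?kn// big_nat1 zS z0 ogm_step_last.
  move: (theta n 1) (t0 1) => b b0; apply/rowP => i; rewrite !mxE /=; by field.
have {}IH := IH (ltnW kn).
have e1 : x k.+1 = x k -
    (\sum_(0 <= j < k) ogm_step n k.+1 j *: G j + ogm_step n k.+1 k *: G k).
  by rewrite (xE k.+1) ?(ltnW kn)// big_nat_recr.
have -> : x k.+2 = x k.+1 - (\sum_(0 <= j < k) ogm_step n k.+2 j *: G j +
    ogm_step n k.+2 k *: G k + ogm_step n k.+2 k.+1 *: G k.+1).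
  by rewrite (xE k.+2) ?kn// !big_nat_recr.
rewrite zS.
have -> : \sum_(0 <= j < k) ogm_step n k.+2 j *: G j =
    ((theta n k.+1 - 1) / theta n k.+2) *: (\sum_(0 <= j < k) ogm_step n k.+1 j *: G j).
  rewrite scaler_sumr; apply: eq_big_nat => j /andP[_ jk].
  by rewrite ogm_step_early// scalerA.
rewrite ogm_step_last ogm_step_prev.
move: (theta n k.+1) (theta n k.+2) (t0 k.+2) IH => a b b0 IH.
move: (\sum_(0 <= j < k) _) (ogm_step _ _ _) e1 => S o e1.
apply/rowP => i; move/rowP: IH => /(_ i); move/rowP: e1 => /(_ i); rewrite !mxE => e1 IH.
have -> : z k.+1 0 i = a * x k.+1 0 i - (a - 1) * (x k 0 i - G k 0 i).
  by rewrite IH; ring.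
have -> : x k 0 i = x k.+1 0 i + (S 0 i + o * G k 0 i) by rewrite e1; ring.
by field.
Qed.

(** * Smooth convex functions *)

Section smooth_functions.
Context {R : realType} {d : nat}.
Implicit Types (f : 'rV[R]_d -> R) (x y v : 'rV[R]_d).

Lemma derive_grad f x v : differentiable f x -> 'D_v f x = dotv (grad f x) v.
Proof.
move=> df; rewrite deriveE// {1}(row_sum_delta v) linear_sum.
by apply: eq_bigr => i _; rewrite linearZ /= mxE deriveE// mulrC.
Qed.

Lemma is_derive_line f x v (t : R) : (forall y, differentiable f y) ->
  is_derive t 1 (fun r : R => f (x + r *: v)) (dotv (grad f (x + t *: v)) v).
Proof.
move=> df.
have E : (fun h : R => h^-1 *: (f (x + (h *: 1 + t) *: v) - f (x + t *: v))) =
    (fun h : R => h^-1 *: (f (h *: v + (x + t *: v)) - f (x + t *: v))).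
  apply/funext => h; congr (_ *: (f _ - _)).
  by rewrite [h *: 1]mulr1 scalerDl addrCA.
have dv : derivable f (x + t *: v) v by exact: diff_derivable (df _).
have dl : derivable (fun r : R => f (x + r *: v)) t 1.
  by rewrite /derivable /= E.
by apply: DeriveDef => //; rewrite -derive_grad// /derive /= E.
Qed.

(* Mean value theorem for r |-> f (x + r v) - r^2 c on [0, 1]. *)
Lemma mvt_line f x v (c : R) : (forall y, differentiable f y) ->
  exists2 t : R, 0 < t < 1 &
    f (x + v) - f x - c = dotv (grad f (x + t *: v)) v - 2 * t * c.
Proof.
move=> df.
pose p (r : R) := f (x + r *: v) - c * r ^+ 2.
have dp (r : R) : is_derive r 1 p (dotv (grad f (x + r *: v)) v - 2 * r * c).
  have := is_derive_line x v r df => dl.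
  apply: is_derive_eq.
  by rewrite /GRing.scale /=; ring.
have [|t] := @MVT R p _ 0 1 ltr01 (fun r _ => dp r).
  apply: continuous_subspaceT => r.
  by apply: differentiable_continuous; apply/derivable1_diffP; case: (dp r).
rewrite in_itv /= => t01; rewrite /p scale0r addr0 scale1r => e.
exists t => //; lra.
Qed.

Lemma le_of_le_add_mul (a b c : R) :
  (forall t, 0 < t < 1 -> a <= b + t * c) -> a <= b.
Proof.
move=> H; rewrite leNgt; apply/negP => ba.
have [c0|c0] := leP c 0.
  have := H (1 / 2) _; rewrite divr_gt0//= => /(_ ltac:(lra)); nra.
(* An explicit witness replaces the limit [t -> 0]: [t (a - b + c)] is half the gap [a - b], so
   [t c] stays below the gap. *)
pose t := (a - b) / (2 * (a - b + c)).
have D : 0 < 2 * (a - b + c) by lra.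
have tD : t * (2 * (a - b + c)) = a - b by rewrite divfK// gt_eqF.
have t0 : 0 < t by rewrite divr_gt0//; lra.
have := H t; rewrite t0 /= ltr_pdivrMr// => /(_ ltac:(lra)).
nra.
Qed.

(** Taking [c = |v|^2 / 2] in [mvt_line] gives the sharp constant 1/2 from the bound [t |v|^2] on
    [<grad f (x + t v) - grad f x, v>], without integration. *)
Lemma descent f x v : smooth 1 f ->
  f (x + v) <= f x + dotv (grad f x) v + dotv v v / 2.
Proof.
move=> [df lf].
have [t /andP[t0 t1] e] := mvt_line x v (dotv v v / 2) df.
suff : dotv (grad f (x + t *: v)) v <= dotv (grad f x) v + t * dotv v v by lra.
rewrite -lerBlDl -dotvNl -dotvDl (le_trans (cauchy_schwarz _ _))//.
rewrite -enorm_sq expr2 mulrA ler_wpM2r ?sqrtr_ge0//.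
have := lf (x + t *: v) x; rewrite mul1r => /le_trans; apply.
rewrite [x + _]addrC addrK /enorm dotvZl dotvZr mulrA -expr2.
by rewrite sqrtrM ?sqr_ge0// sqrtr_sqr gtr0_norm.
Qed.

Lemma linear_minorant f x v : smooth 1 f ->
  f x + dotv (grad f x) v <= f (x + v) + dotv v v.
Proof.
move=> [df lf].
have [t /andP[t0 t1] e] := mvt_line x v 0 df.
suff : dotv (grad f x) v <= dotv (grad f (x + t *: v)) v + dotv v v by lra.
rewrite -lerBlDl -dotvNl -dotvDl (le_trans (cauchy_schwarz _ _))//.
rewrite -enorm_sq expr2 ler_wpM2r ?sqrtr_ge0//.
have := lf x (x + t *: v); rewrite mul1r => /le_trans; apply.
rewrite opprD addrA subrr sub0r /enorm dotvNl dotvNr opprK dotvZl dotvZr mulrA -expr2.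
rewrite sqrtrM ?sqr_ge0// sqrtr_sqr gtr0_norm//.
by rewrite ler_piMl ?sqrtr_ge0// ltW.
Qed.

Lemma convex_line f x y (t : R) : convex_function [set: 'rV[R]_d] f ->
  0 < t < 1 -> f (x + t *: (y - x)) <= (1 - t) * f x + t * f y.
Proof.
move=> cf /andP[t0 t1].
have t01 : Itv.spec (@Itv.num_sem R) (Itv.Real `[0%Z, 1%Z]) t.
  by rewrite /Itv.num_sem /= num_real/= in_itv/= !ltW.
have : f (t *: y + (1 - t) *: x) <= t * f y + (1 - t) * f x.
  by apply: (cf (Itv.mk t01) y x); rewrite inE.
rewrite [leRHS]addrC.
suff -> : t *: y + (1 - t) *: x = x + t *: (y - x) by [].
by apply/rowP => i; rewrite !mxE; ring.
Qed.

(** [linear_minorant] and convexity bound [f (x + t (y - x))] from both sides; after division by [t]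
    the error is [t |y - x|^2], which tends to 0. *)
Lemma convex_grad f x y : convex_function [set: 'rV[R]_d] f -> smooth 1 f ->
  f x + dotv (grad f x) (y - x) <= f y.
Proof.
move=> cf sf; apply: (@le_of_le_add_mul _ _ (dotv (y - x) (y - x))) => t t01.
have h1 := convex_line x y cf t01; case/andP: t01 => t0 t1.
rewrite -(ler_pM2l t0).
have := linear_minorant x (t *: (y - x)) sf; rewrite !dotvZr !dotvZl; lra.
Qed.

(** Both bounds are taken at the point [x - g]: convexity from [y] below, the descent inequality
    from [x] above. *)
Lemma cocoercive f x y : convex_function [set: 'rV[R]_d] f -> smooth 1 f ->
  f y + dotv (grad f y) (x - y)
    + dotv (grad f x - grad f y) (grad f x - grad f y) / 2 <= f x.
Proof.
move=> cf sf; set g := grad f x - grad f y.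
have := convex_grad y (x - g) cf sf; have := descent x (- g) sf.
have : dotv g g = dotv (grad f x) g - dotv (grad f y) g.
  by rewrite -dotvNl -dotvDl.
rewrite !dotvE; lra.
Qed.

End smooth_functions.

(** * The convergence rate *)

Lemma theta1_sq (R : realType) (n : nat) : (2 <= n)%N ->
  theta n 1 ^+ 2 = (3 + Num.sqrt 5) / 2 :> R.
Proof.
move=> n2; rewrite /= ltn_eqF// expr1n mulr1.
have -> : 1 + 4 = 5 :> R by ring.
have : Num.sqrt (5 : R) ^+ 2 = 5 by rewrite sqr_sqrtr.
move: (Num.sqrt _) => q qE; transitivity ((1 + 2 * q + q ^+ 2) / 4); first by field.
by rewrite qE; field.
Qed.

Lemma composite_ogm_rate (R : realType) (d : nat) (f : 'rV[R]_d -> R)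
    (h : 'rV[R]_d -> \bar R) (xs : 'rV[R]_d) (n : nat) (x s : nat -> 'rV[R]_d) :
  convex_function [set: 'rV[R]_d] f -> smooth 1 f ->
  (forall y, h y != -oo%E) -> h xs \is a fin_num ->
  (2 <= n)%N -> composite_ogm f h n x s ->
  (composite f h (x n) - composite f h xs <=
    ((3 + Num.sqrt 5) / (8 * theta n n ^+ 2) * enorm (x 0%N - xs) ^+ 2)%:E)%E.
Proof.
move=> cf sf hNy hxs n2 ogm.
(* The subgradient inequality of [s_k] at [xs], where [h] is finite, rules out [h (x_k) = +oo]. *)
have hx k : (0 < k <= n)%N -> h (x k) = (fine (h (x k)))%:E.
  move=> /ogm[_ /(_ xs)]; rewrite -(fineK hxs) => hk; rewrite fineK// fin_numE hNy/=.
  by apply/negP => /eqP e; rewrite e in hk.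
pose gs := grad f xs.
pose X k := x k - xs; pose g k := grad f (x k) - gs; pose sg k := s k + gs.
(* The linear terms in [gs] cancel in [fk + hk]. The point [x_0] may lie outside the domain of [h],
   where [fine] returns 0; the inequalities for [hk] start at index 1. *)
pose fk k := f (x k) - f xs - dotv gs (X k).
pose hk k := fine (h (x k)) - fine (h xs) + dotv gs (X k).
pose G k := grad f (x k) + s k.+1.
pose z k := X 0%N - \sum_(0 <= j < k) (2 * theta n j) *: G j.
have GE k : g k + sg k.+1 = G k by rewrite /g /sg [s _ + _]addrC addrA subrK.
have z0 : z 0%N = X 0%N by rewrite /z big_nil subr0.
have zS k : z k.+1 = z k - (2 * theta n k) *: G k.
  by rewrite /z big_nat_recr//= opprD addrA.
have XE k : (1 <= k <= n)%N ->
    X k = X k.-1 - \sum_(0 <= j < k) ogm_step n k j *: G j.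
  by move=> kn; rewrite /X (ogm _ kn).1 addrAC.
have mom := ogm_momentum XE z0 zS.
have XB i j : X i - X j = x i - x j by rewrite /X opprB addrA subrK.
have gB i j : g i - g j = grad f (x i) - grad f (x j) by rewrite /g opprB addrA subrK.
have h_real i y : (0 < i <= n)%N -> h y \is a fin_num ->
    fine (h (x i)) + dotv (s i) (y - x i) <= fine (h y).
  move=> iN hy; have [_ /(_ y)] := ogm _ iN.
  by rewrite (hx _ iN) -(fineK hy) -EFinD lee_fin.
have key : theta n n ^+ 2 * (fk n + hk n) <= theta n 1 ^+ 2 / 4 * dotv (X 0%N) (X 0%N).
  apply: (@potential_bound R d n (theta n) fk hk X z g sg) => //.
  - exact: theta_ge1.
  - by move=> k kn; rewrite thetaS ltn_eqF// mul1r.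
  - by case: n n2 {ogm hx z z0 zS XE mom h_real} => // m _; rewrite thetaS eqxx.
  - by move=> k _; rewrite GE.
  - by move=> k kn; rewrite GE; exact: mom.
  - move=> k _; rewrite gB XB.
    have := cocoercive (x k) (x k.+1) cf sf.
    rewrite /fk /g /X !dotvE; lra.
  - move=> k _.
    have := cocoercive xs (x k) cf sf; rewrite -/gs.
    have -> : dotv (gs - grad f (x k)) (gs - grad f (x k)) = dotv (g k) (g k).
      by rewrite -opprB dotvNl dotvNr opprK.
    move: (dotv (g k) (g k)) => q.
    rewrite /fk /g /X !dotvE; lra.
  - move=> i j iN jN; rewrite XB.
    have hj : h (x j) \is a fin_num by rewrite hx.
    have := h_real i (x j) iN hj.
    rewrite /hk /sg /X !dotvE; lra.
  - move=> i iN; have := h_real i xs iN hxs.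
    rewrite /hk /sg /X !dotvE; lra.
have nN : (0 < n <= n)%N by rewrite leqnn (leq_trans _ n2).
rewrite /composite (hx _ nN) -(fineK hxs) -!EFinD lee_fin.
have t0 : 0 < theta n n :> R by rewrite (lt_le_trans ltr01) ?theta_ge1.
rewrite enorm_sq -(ler_pM2l (exprn_gt0 2 t0)).
have -> : theta n n ^+ 2 * ((3 + Num.sqrt 5) / (8 * theta n n ^+ 2) *
    dotv (x 0%N - xs) (x 0%N - xs)) = theta n 1 ^+ 2 / 4 * dotv (X 0%N) (X 0%N).
  by rewrite theta1_sq//; field; rewrite gt_eqF.
apply: le_trans key; rewrite le_eqVlt; apply/orP; left; apply/eqP.
by rewrite /fk /hk; ring.
Qed.

(** * Asymptotics of the rate *)

Section asymptotics.
Context {R : realType}.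

(** Since [(b - 1/2)^2 = a^2 + 1/4], each increment exceeds 1/2 by at most [1 / (4 (k + 2))]. The
    square root is a convenient [o(k)] majorant of the total excess, as it grows by at least
    [1 / (2 sqrt (k + 2))]. *)
Lemma theta_bounds n k : (k < n)%N ->
  (k.+2%:R / 2 <= theta n k :> R) &&
  (theta n k <= k.+2%:R / 2 + Num.sqrt k.+1%:R :> R).
Proof.
elim: k => [|k IH] kn.
  by rewrite /= sqrtr1; apply/andP; split; lra.
have /andP[lo up] := IH (ltnW kn).
have := @thetaS R n k; rewrite ltn_eqF// mul1r.
have := @theta_ge1 R n k.+1.
move: (theta n k) (theta n k.+1) lo up => a b lo up b1 hb.
have p2 : Num.sqrt (k.+1%:R : R) ^+ 2 = k.+1%:R by rewrite sqr_sqrtr.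
have q2 : Num.sqrt (k.+2%:R : R) ^+ 2 = k.+2%:R by rewrite sqr_sqrtr.
have p0 := sqrtr_ge0 (k.+1%:R : R).
have pq : Num.sqrt (k.+1%:R : R) <= Num.sqrt k.+2%:R by rewrite ler_wsqrtr// ler_nat.
have q1 : 1 <= Num.sqrt (k.+2%:R : R).
  by rewrite -[leLHS]sqrtr1 ler_wsqrtr// ler1n.
move: (Num.sqrt k.+1%:R) (Num.sqrt k.+2%:R) p2 q2 p0 pq q1 up => p q p2 q2 p0 pq q1 up.
have e3 : k.+3%:R = q ^+ 2 + 1 :> R by rewrite q2 natr1.
have e2 : q ^+ 2 = p ^+ 2 + 1 by rewrite q2 p2 natr1.
rewrite e3; rewrite -q2 in lo up.
have ab : a + 1 / 2 <= b by rewrite leNgt; apply/negP => ?; nra.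
have a0 : 0 <= a by nra.
apply/andP; split; first lra.
pose D := b - 1 / 2 - a.
have D0 : 0 <= D by rewrite /D; lra.
have DE : D * (b - 1 / 2 + a) = 1 / 4.
  transitivity (b ^+ 2 - b - a ^+ 2 + 1 / 4); first by rewrite /D; field.
  by rewrite hb; ring.
have qa : q ^+ 2 <= b - 1 / 2 + a by lra.
have Dq : D * q ^+ 2 <= 1 / 4 by rewrite -DE ler_wpM2l.
have qp : 1 / 2 <= (q - p) * q by nra.
suff : D <= q - p by rewrite /D; lra.
have q0 : 0 < q ^+ 2 by nra.
rewrite -(ler_pM2r q0); nra.
Qed.

(** The last step multiplies by about [sqrt 2]: [b^2 - b = 2 a^2] gives [2 a^2 <= b^2] and
    [b <= sqrt 2 a + 1]. *)
Lemma theta_last_bounds n (q := Num.sqrt n.+1%:R : R) : (0 < n)%N ->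
  [/\ n%:R ^+ 2 <= 2 * theta n n ^+ 2 :> R
    & 2 * theta n n ^+ 2 <= (q ^+ 2 + 2 * q + 2) ^+ 2].
Proof.
case: n @q => // m q _.
have q2 : q ^+ 2 = m.+2%:R by rewrite sqr_sqrtr.
have /andP[lo up] := theta_bounds (ltnSn m).
have mq : Num.sqrt (m.+1%:R : R) <= q by rewrite ler_wsqrtr// ler_nat.
have q0 : 0 <= q by exact: sqrtr_ge0.
have := @thetaS R m.+1 m; rewrite eqxx.
have := @theta_ge1 R m.+1 m.+1.
have e1 : m.+1%:R = q ^+ 2 - 1 :> R by rewrite q2 -[m.+2%:R]natr1 addrK.
have {}up : theta m.+1 m <= q ^+ 2 / 2 + q by rewrite q2; lra.
rewrite -q2 in lo; rewrite e1.
have a1 := @theta_ge1 R m.+1 m.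
have q21 : 1 <= q ^+ 2 by rewrite q2 ler1n.
move: (theta _ m) (theta _ m.+1) q lo up a1 q21 q0 {q2 mq e1}
  => a b q lo up a1 q21 q0 b1 hb.
have a0 : q ^+ 2 <= 2 * a by lra.
split.
  have : (q ^+ 2) ^+ 2 <= (2 * a) ^+ 2 by rewrite ler_pXn2r// nnegrE; lra.
  nra.
have r2 : Num.sqrt (2 : R) ^+ 2 = 2 by rewrite sqr_sqrtr.
have r0 := sqrtr_ge0 (2 : R).
move: (Num.sqrt 2) r2 r0 => r r2 r0.
have rl : r <= 2 by nra.
have r1 : 1 <= r by nra.
have bu : b <= r * a + 1.
  rewrite leNgt; apply/negP => lt.
  have h1 : 0 <= r * a by rewrite mulr_ge0//; lra.
  have h2 : (r * a) ^+ 2 = 2 * a ^+ 2 by rewrite exprMn r2.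
  nra.
have rb : r * b <= q ^+ 2 + 2 * q + 2.
  have := ler_wpM2l r0 bu.
  have -> : r * (r * a + 1) = 2 * a + r by rewrite mulrDr mulrA -expr2 r2 mulr1.
  by lra.
have -> : 2 * b ^+ 2 = (r * b) ^+ 2 by rewrite exprMn r2.
have b0 : 0 <= b by lra.
by rewrite ler_pXn2r// nnegrE ?mulr_ge0//; nra.
Qed.

Lemma theta_ratio_bounds n : (0 < n)%N ->
  1 - 10 * Num.sqrt (harmonic n : R) <=
    n%:R ^+ 2 / (2 * (theta n n : R) ^+ 2) <= 1.
Proof.
move=> n0; have [lo up] := theta_last_bounds n0.
have t0 : 0 < 2 * theta n n ^+ 2 :> R.
  by rewrite mulr_gt0// exprn_gt0// (lt_le_trans ltr01) ?theta_ge1.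
apply/andP; split; last by rewrite ler_pdivrMr// mul1r.
have hE : Num.sqrt (harmonic n : R) = (Num.sqrt n.+1%:R)^-1 by rewrite /harmonic sqrtrV.
have q2 : Num.sqrt (n.+1%:R : R) ^+ 2 = n.+1%:R by rewrite sqr_sqrtr.
have q1 : 1 <= Num.sqrt (n.+1%:R : R) by rewrite -[leLHS]sqrtr1 ler_wsqrtr// ler1n.
have nE : n%:R = Num.sqrt (n.+1%:R : R) ^+ 2 - 1 by rewrite q2 -natr1 addrK.
rewrite hE ler_pdivlMr// nE.
move: (Num.sqrt _) (2 * _) q1 up t0 {lo hE q2 nE} => q T q1 up t0.
(* The constant 10 makes the lower bound nonpositive for [q <= 10]; for larger [q] it leaves a
   polynomial difference with positive coefficients only. *)
have [q10|q10] := leP q 10.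
  have c0 : 1 - 10 / q <= 0 by rewrite subr_le0 ler_pdivlMr; lra.
  by apply: le_trans (sqr_ge0 _); exact: mulr_le0_ge0 c0 (ltW t0).
have c0 : 0 <= 1 - 10 / q by rewrite subr_ge0 ler_pdivrMr; lra.
apply: le_trans (ler_wpM2l c0 up) _.
have q0 : 0 < q by lra.
rewrite -(ler_pM2l q0).
have -> : q * ((1 - 10 / q) * (q ^+ 2 + 2 * q + 2) ^+ 2) =
  (q - 10) * (q ^+ 2 + 2 * q + 2) ^+ 2 by field; rewrite gt_eqF.
rewrite -subr_ge0.
have -> : q * (q ^+ 2 - 1) ^+ 2 - (q - 10) * (q ^+ 2 + 2 * q + 2) ^+ 2 =
  6 * q ^+ 4 + 30 * q ^+ 3 + 72 * q ^+ 2 + 77 * q + 40 by ring.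
by rewrite !addr_ge0// mulr_ge0// ?exprn_ge0//; lra.
Qed.

Lemma rate_asymp : asymp_equiv
  (fun n => (3 + Num.sqrt 5) / (8 * (theta n n : R) ^+ 2))
  (fun n => (3 + Num.sqrt 5) / (4 * n%:R ^+ 2)).
Proof.
apply: (@squeeze_cvgr _ _ _ R (fun n => 1 - 10 * Num.sqrt (harmonic n)) (fun=> 1)).
- near=> n.
  have n0 : (0 < n)%N by near: n; exact: nbhs_infty_gt.
  have -> : (3 + Num.sqrt 5) / (8 * (theta n n : R) ^+ 2) /
      ((3 + Num.sqrt 5) / (4 * n%:R ^+ 2)) = n%:R ^+ 2 / (2 * theta n n ^+ 2).
    have := sqrtr_ge0 (5 : R); have := @theta_ge1 R n n.
    have : 0 < n%:R :> R by rewrite ltr0n.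
    move: (Num.sqrt _) (theta _ _) => q t n1 t1 q0.
    by field; rewrite !gt_eqF//; lra.
  exact: theta_ratio_bounds.
- rewrite -[X in _ --> X]subr0 -[X in _ - X](mulr0 10).
  apply: cvgB; first exact: cvg_cst.
  apply: cvgMr; rewrite -[X in _ --> X](@sqrtr0 R).
  by apply: continuous_cvg; [exact: sqrt_continuous|exact: cvg_harmonic].
- exact: cvg_cst.
Unshelve. all: by end_near. Qed.

End asymptotics.

Theorem theorem4p7 (R : realType) :
  (forall (d : nat) (f : 'rV[R]_d -> R) (h : 'rV[R]_d -> \bar R)
          (xs : 'rV[R]_d),
      convex_function [set: 'rV[R]_d] f -> smooth 1 f ->
      proper_function h -> closed_function h -> econvex h ->
      minimizer (composite f h) xs ->
      forall (n : nat) (x s : nat -> 'rV[R]_d), (2 <= n)%N ->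
      composite_ogm f h n x s ->
      (composite f h (x n) - composite f h xs <=
        ((3 + Num.sqrt 5) / (8 * theta n n ^+ 2) *
          enorm (x 0%N - xs) ^+ 2)%:E)%E)
  /\
  asymp_equiv (fun n => (3 + Num.sqrt 5) / (8 * (theta n n : R) ^+ 2))
              (fun n => (3 + Num.sqrt 5) / (4 * n%:R ^+ 2)).
Proof.
split; last exact: rate_asymp.
move=> d f h xs cf sf [hNy [y hy]] _ _ hmin n x s n2 ogm.
apply: (composite_ogm_rate cf sf hNy _ n2 ogm).
(* If [h xs = +oo], minimality forces [h y = +oo], against the choice of [y] from properness. *)
rewrite fin_numE hNy/=; apply/negP => /eqP hxs.
have := hmin y; rewrite /composite hxs addey// leye_eq.
by case: (h y) (hNy y) hy.
Qed.
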